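(* Let $H$ be an infinite-dimensional Hilbert space over $\mathbf K$ and let $T$ be a compact operator on $H$. Then the set of non-zero eigenvalues of $T$ is $$\sigma_p(T)\setminus\{0\}=\{\lambda\in\mathbf K\setminus\{0\}:\delta^{T^*-\bar\lambda I}\in T\mathcal P(H)\},$$ where $\sigma_p(T)$ denotes the point spectrum of $T$.
   Context: $\mathbf K=\mathbb R$ or $\mathbb C$. $\mathcal P(H)$ is the category whose objects are the proper (linear) subspaces of $H$ and whose morphisms are all linear maps between them, with subspace inclusions as inclusions. A cone $\delta$ in $\mathcal P(H)$ with vertex $N$ assigns to each proper subspace $M$ a linear map $\delta(M):M\to N$ such that $\delta(M')=\delta(M)|_{M'}$ whenever $M'\subseteq M$. For a linear operator $S$ on $H$ with range $R(S)$, $\delta^S$ denotes the family $\delta^S(M)=S|_M:M\to R(S)$, which is a cone in $\mathcal P(H)$ with vertex $R(S)$ when $R(S)$ is a proper subspace. $T\mathcal P(H)$ denotes the semigroup of normal cones in $\mathcal P(H)$; it is identified with the semigroup of non-surjective linear operators on $H$ via $S\mapsto\delta^S$, i.e. $T\mathcal P(H)=\{\delta^S:S\text{ a non-surjective linear operator on }H\}$, so that $\delta^S\in T\mathcal P(H)$ means that $S$ is not surjective. $T^*$ is the adjoint of $T$ and $I$ the identity operator. *)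

(* Defs.v *)
From HB Require Import structures.
From mathcomp Require Import all_boot all_order all_algebra.
From mathcomp Require Import all_classical all_reals all_analysis.
From mathcomp Require Import complex.

Set Implicit Arguments.
Unset Strict Implicit.
Unset Printing Implicit Defensive.

Import Order.TTheory GRing.Theory Num.Theory.
Import numFieldNormedType.Exports.

Local Open Scope classical_set_scope.
Local Open Scope ring_scope.

Variant scalar_kind := RealScalars | ComplexScalars.

Definition scalars (R : realType) (k : scalar_kind) : numFieldType :=
  match k with
  | RealScalars => R
  | ComplexScalars => R[i]
  end.

Definition scalar_conj (R : realType) (k : scalar_kind) :
    scalars R k -> scalars R k :=
  match k with
  | RealScalars => id
  | ComplexScalars => fun z : R[i] => z^*
  end.

(* A Hilbert space is a complete normed space whose norm comes from an inner
   product, linear on the left and conj-linear on the right; {dot H for conj}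
   contains Hermitian symmetry and definite positivity. *)
Definition norm_from_dot (K : numFieldType) (conj : K -> K)
    (H : normedModType K) (dot : {dot H for conj}) :=
  forall x : H, `|x| ^+ 2 = dot x x.

Definition finite_dimensional (K : numFieldType) (H : lmodType K) :=
  exists (n : nat) (e : 'I_n -> H),
    forall x : H, exists c : 'I_n -> K, x = \sum_(i < n) c i *: e i.

Definition compact_operator (K : numFieldType) (H : normedModType K)
    (T : {linear H -> H}) :=
  forall B : set H, bounded_set B -> precompact (T @` B).

Definition point_spectrum (K : numFieldType) (H : lmodType K)
    (T : {linear H -> H}) : set K :=
  [set lambda | exists2 x : H, x != 0 & T x = lambda *: x].

Definition is_adjoint (K : numFieldType) (conj : K -> K) (H : lmodType K)
    (dot : {dot H for conj}) (T S : {linear H -> H}) :=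
  forall x y : H, dot (T x) y = dot x (S y).

(* The adjoint is unique when it exists, and exists for every bounded operator
   on a Hilbert space; the value \0 is junk. *)
Definition adjoint (K : numFieldType) (conj : K -> K) (H : lmodType K)
    (dot : {dot H for conj}) (T : {linear H -> H}) : {linear H -> H} :=
  match pselect (exists S, is_adjoint dot T S) with
  | left exS => sval (cid exS)
  | right _ => \0
  end.

Section Cones.
Context (K : numFieldType) (H : lmodType K).

(* Linear subspaces are the elements M of submodClosed H; their vectors form
   the type subspace M, so that a morphism from M to N in the category of
   subspaces is an element of {linear subspace M -> subspace N}. *)
Definition subspace (M : submodClosed H) : Type := {x : H | x \in M}.

HB.instance Definition _ (M : submodClosed H) := SubChoice.on (subspace M).
HB.instance Definition _ (M : submodClosed H) :=
  [SubChoice_isSubLmodule of subspace M by <:].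

Definition is_proper (M : submodClosed H) := exists x : H, x \notin M.

Record proper_subspace := ProperSubspace {
  proper_carrier :> submodClosed H;
  properP : is_proper proper_carrier
}.

Definition incl (M' M : submodClosed H) (sub : {subset M' <= M})
    (x : subspace M') : subspace M :=
  exist _ (val x) (sub _ (valP x)).

Record map_family := MapFamily {
  vertex : submodClosed H;
  component : forall M : proper_subspace, {linear subspace M -> subspace vertex}
}.

Definition is_cone (delta : map_family) :=
  is_proper (vertex delta) /\
  forall (M' M : proper_subspace) (sub : {subset M' <= M}) (x : subspace M'),
    component delta M' x = component delta M (incl sub x).

Section OperatorCone.
Variable S : {linear H -> H}.

Definition range_of : {pred H} := [pred y | `[< exists x, S x = y >]].

Fact range_of_submod : subsemimod_closed range_of.
Proof.
split=> [|a y /asboolP[x <-]]; last first.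
  by apply/asboolP; exists (a *: x); rewrite linearZ.
split=> [|y z /asboolP[x <-] /asboolP[t <-]].
  by apply/asboolP; exists 0; rewrite linear0.
by apply/asboolP; exists (x + t); rewrite linearD.
Qed.

HB.instance Definition _ := GRing.isSubmodClosed.Build K H range_of
  range_of_submod.

Fact mem_range_of x : S x \in range_of.
Proof. by apply/asboolP; exists x. Qed.

Definition restrict_op (M : submodClosed H) (x : subspace M) : subspace range_of :=
  exist _ (S (val x)) (mem_range_of (val x)).

Fact restrict_op_linear M : linear (@restrict_op M).
Proof. by move=> a x y; apply: val_inj; rewrite /= linearP. Qed.

HB.instance Definition _ M := GRing.isLinear.Build K (subspace M)
  (subspace range_of) _ (@restrict_op M) (@restrict_op_linear M).

Definition operator_family : map_family :=
  @MapFamily range_of (fun M => @restrict_op M).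

Definition surjective_op := forall y : H, exists x : H, S x = y.

Lemma operator_family_cone : ~ surjective_op -> is_cone operator_family.
Proof.
move=> /existsNP[y ny]; split; first by exists y; apply/negP => /asboolP.
by move=> M' M sub x; apply: val_inj.
Qed.

End OperatorCone.

(* The semigroup T P(H) of normal cones, described through its identification
   with the non-surjective linear (possibly unbounded) operators on H. *)
Definition TP (delta : map_family) : Prop :=
  is_cone delta /\
  exists S : {linear H -> H}, ~ surjective_op S /\ delta = operator_family S.

End Cones.

(* Main.v *)
Require Import Defs.
From HB Require Import structures.
From mathcomp Require Import all_boot all_order all_algebra.
From mathcomp Require Import all_classical all_reals all_analysis.
From mathcomp Require Import complex ring lra.

Import Order.TTheory GRing.Theory Num.Theory.
Import numFieldNormedType.Exports.

Local Open Scope classical_set_scope.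
Local Open Scope ring_scope.

(** Write [A = T - lambda], so that [T^* - conj lambda] is the adjoint of [A].
    The family of restrictions of an operator [S] lies in [TP] exactly when [S]
    is not surjective: a surjective [S] has a non-proper vertex, and otherwise
    [S] is its own witness. So the claim is that, for [lambda != 0], [A] fails
    to be injective if and only if [A^*] fails to be surjective.

    If [T x = lambda x] with [x != 0], then [<x, A^* y> = <A x, y> = 0] for all
    [y], so [x] is orthogonal to the range of [A^*] and is not in it.

    Conversely, let [A] be injective. Compactness of [T] and [lambda != 0] make
    [A] bounded below ([compact_operator_bounded_below]). Then, for each [y],
    the functional [x |-> <x, y>] is dominated by a multiple of [|A x|], hence
    factors through [A] as [x |-> <A x, z>] ([riesz_factor]), which says that
    [A^* z = y] ([adjoint_surjective]).

    The lemma [riesz_factor] is a form of the Riesz representation theorem; with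
    the identity as the factored operator it also yields the existence of [T^*]
    ([adjointP]), without which [adjoint dot T] would be a junk value. It is
    proved by minimising [|A x|^2 - 2 Re (f x)]: the first-order condition at an
    approximate minimiser says that [f v] is close to [<A v, A x>], and this
    makes the images under [A] of a minimising sequence converge to the
    representing vector.

    Both fields of scalars are treated at once through the real part of a scalar
    and the real-valued norm [nrm]; real scalars are enough for every estimate,
    since infima and extreme values live in [R]. *)

(** * The real part of a scalar and the real-valued norm *)

Definition re_part {R : realType} {k : scalar_kind} : scalars R k -> R :=
  match k with
  | RealScalars => id
  | ComplexScalars => fun z : R[i] => complex.Re z
  end.

Definition of_real {R : realType} {k : scalar_kind} : R -> scalars R k :=
  match k with
  | RealScalars => id
  | ComplexScalars => real_complex R
  end.

Section Scalars.
Context {R : realType} {k : scalar_kind}.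
Local Notation K := (scalars R k).
Implicit Types (z w : K) (s t : R).

Lemma re_is_zmod_morphism : zmod_morphism (@re_part R k).
Proof. by case: k => [|[a b] [c d]]. Qed.

HB.instance Definition _ :=
  GRing.isZmodMorphism.Build K R re_part re_is_zmod_morphism.

Lemma re_of_real t : re_part (of_real t : K) = t.
Proof. by case: k. Qed.

Lemma of_realK z : 0 <= z -> of_real (re_part z) = z.
Proof.
by move: z; case: k => //= z z0; rewrite RRe_real// ger0_real.
Qed.

Lemma re_of_realM t z : re_part (of_real t * z) = t * re_part z.
Proof. by move: z; case: k => //= -[a b] /=; rewrite mul0r subr0. Qed.

Lemma of_real_le s t : (of_real s <= of_real t :> K) = (s <= t).
Proof. by case: k => //=; rewrite lecR. Qed.

Lemma of_real_lt s t : (of_real s < of_real t :> K) = (s < t).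
Proof. by case: k => //=; rewrite ltcR. Qed.

Lemma of_real1 : of_real 1 = 1 :> K.
Proof. by case: k. Qed.

Lemma of_real0 : of_real 0 = 0 :> K.
Proof. by case: k. Qed.

Lemma re_conj z : re_part (scalar_conj z) = re_part z.
Proof. by move: z; case: k => // -[]. Qed.

Lemma scalar_conjK z : scalar_conj (scalar_conj z) = z.
Proof. by move: z; case: k => //= z; rewrite conjCK. Qed.

Lemma conj_mul_norm z : scalar_conj z * z = `|z| ^+ 2.
Proof.
by move: z; case: k => /= z; rewrite ?normCKC// -expr2 real_normK// num_real.
Qed.

Lemma norm_conj z : `|scalar_conj z| = `|z|.
Proof. by move: z; case: k => //= z; rewrite norm_conjC. Qed.

Lemma of_real_ge0 t : (0 <= of_real t :> K) = (0 <= t).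
Proof. by rewrite -of_real0 of_real_le. Qed.

Lemma of_real_gt0 t : (0 < of_real t :> K) = (0 < t).
Proof. by rewrite -of_real0 of_real_lt. Qed.

Lemma of_realM s t : of_real (s * t) = of_real s * of_real t :> K.
Proof. by case: k => //=; rewrite rmorphM. Qed.

Lemma of_realD s t : of_real (s + t) = of_real s + of_real t :> K.
Proof. by case: k => //=; rewrite rmorphD. Qed.

Lemma normr_of_real t : `|of_real t : K| = of_real `|t|.
Proof. by case: k => //=; rewrite normc_def /= expr0n addr0 sqrtr_sqr. Qed.

Lemma norm_re_le z : `|re_part z| <= re_part `|z|.
Proof.
move: z; case: k => //= z; have := normc_ge_Re z.
by rewrite lecE => /andP[].
Qed.

End Scalars.

(** The norm of a normed space over [K] takes its values in [K]; [nrm] is the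
    same number seen in [R], where suprema and the total order are available. *)
Definition nrm {R : realType} {k : scalar_kind}
    {V : normedZmodType (scalars R k)} (x : V) : R := re_part `|x|.

Section RealNorm.
Context {R : realType} {k : scalar_kind} {V : normedZmodType (scalars R k)}.
Implicit Types x y : V.

Lemma of_real_nrm x : of_real (nrm x) = `|x|.
Proof. by rewrite of_realK. Qed.

Lemma nrm_ge0 x : 0 <= nrm x.
Proof. by rewrite -(@of_real_ge0 _ k) of_real_nrm. Qed.

Lemma nrm_eq0 x : nrm x = 0 -> x = 0.
Proof.
by move=> x0; apply/eqP; rewrite -normr_eq0 -of_real_nrm x0 of_real0.
Qed.

Lemma nrm0 : nrm (0 : V) = 0.
Proof. by rewrite /nrm normr0 raddf0. Qed.

Lemma nrm_triangle x y : nrm (x + y) <= nrm x + nrm y.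
Proof.
by rewrite -(@of_real_le _ k) of_realD !of_real_nrm ler_normD.
Qed.

Lemma nrmN x : nrm (- x) = nrm x.
Proof. by rewrite /nrm normrN. Qed.

Lemma nrm_dist x y : `|nrm x - nrm y| <= nrm (x - y).
Proof.
have h (a b : V) : nrm a - nrm b <= nrm (a - b).
  by have := nrm_triangle (a - b) b; rewrite subrK lerBlDr.
by rewrite ler_norml h andbT -nrmN opprB lerNl opprB h.
Qed.

End RealNorm.

Section RealNormModule.
Context {R : realType} {k : scalar_kind} {V : normedModType (scalars R k)}.
Implicit Types (x y : V) (t : R).

Lemma nrmZ (a : scalars R k) x : nrm (a *: x) = nrm a * nrm x.
Proof.
rewrite /nrm normrZ.
by rewrite -[in LHS](@of_realK _ _ `|a|) ?normr_ge0// re_of_realM.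
Qed.

Lemma nrm_of_real t : nrm (of_real t : scalars R k) = `|t|.
Proof. by rewrite /nrm normr_of_real re_of_real. Qed.

Lemma ball_nrm x y t : ball x (of_real t) y <-> nrm (x - y) < t.
Proof.
by rewrite -ball_normE /ball_ /= -of_real_nrm of_real_lt.
Qed.

Lemma continuous_nrm (f : V -> V) (C : R) :
  (forall x y, nrm (f x - f y) <= C * nrm (x - y)) ->
  continuous (nrm \o f : V -> R).
Proof.
move=> fC x; apply/cvgrPdist_lt => e e0; apply/nbhs_ballP.
have C1 : 0 < `|C| + 1 by rewrite ltr_pwDr.
exists (of_real (e / (`|C| + 1))); first by rewrite /= of_real_gt0 divr_gt0.
move=> y /ball_nrm; rewrite ltr_pdivlMr// => xy /=.
apply: le_lt_trans (nrm_dist _ _) _; apply: le_lt_trans (fC _ _) _.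
apply: le_lt_trans xy; rewrite mulrC ler_wpM2l ?nrm_ge0//.
by rewrite (le_trans (ler_norm C))// lerDl.
Qed.

Lemma nrm_normalize x : x != 0 -> exists2 u, nrm u = 1 & x = of_real (nrm x) *: u.
Proof.
move=> x0; have nx0 : nrm x != 0 by apply: contra_neq x0 => /nrm_eq0.
exists (of_real (nrm x)^-1 *: x).
  by rewrite nrmZ nrm_of_real ger0_norm ?invr_ge0 ?nrm_ge0// mulVf.
by rewrite scalerA -of_realM mulfV// of_real1 scale1r.
Qed.

End RealNormModule.

(** Every positive radius in [K] is the image of one in [R], so completeness can
    be used with [nrm] alone. *)
Lemma nrm_cauchy_cvg (R : realType) (k : scalar_kind)
    (V : completeNormedModType (scalars R k)) (u : nat -> V) :
  (forall e : R, 0 < e -> exists N, forall n, (N <= n)%N -> nrm (u N - u n) < e) ->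
  exists z, forall e : R, 0 < e ->
    exists N, forall n, (N <= n)%N -> nrm (z - u n) < e.
Proof.
move=> uC; have /cauchy_cvg cu : cauchy (u @ \oo).
  apply: cauchy_exP => e e0; have e0' := ltW e0.
  have [|N uN] := uC (re_part e); first by rewrite -(@of_real_gt0 _ k) of_realK.
  exists (u N); exists N => // n /= Nn; rewrite -(of_realK _ e0').
  exact/ball_nrm/uN.
exists (lim (u @ \oo)) => e e0; have /cvg_ballP := cu.
move=> /(_ (of_real e)); rewrite of_real_gt0 => /(_ e0) [N _ uN].
by exists N => n Nn; apply/ball_nrm/uN.
Qed.

(** * Compact operators *)

Section CompactOperators.
Context {R : realType} {k : scalar_kind} {V : normedModType (scalars R k)}.
Implicit Types (x y : V) (t : R).

Lemma compact_unit_ball_image (T : {linear V -> V}) :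
  compact_operator T -> compact (closure (T @` [set x | nrm x <= 1])).
Proof.
move=> cT; rewrite -precompactE; apply: cT.
exists 1; split; first exact: real1.
move=> M M1 x /= x1; apply: ltW; apply: le_lt_trans M1.
by rewrite -of_real_nrm -of_real1 of_real_le.
Qed.

(** The norm attains a maximum on the compact closure of the image of the unit
    ball. *)
Lemma compact_operator_bounded (T : {linear V -> V}) :
  compact_operator T -> exists2 C, 0 <= C & forall x, nrm (T x) <= C * nrm x.
Proof.
move=> /compact_unit_ball_image cB; set B := closure _ in cB.
have TB x : nrm x <= 1 -> B (T x) by move=> x1; apply: subset_closure; exists x.
have [||c _ cmax] := compact_EVT_max _ cB (f := @nrm R k V).
- by exists (T 0); apply: TB; rewrite nrm0.
- apply: continuous_subspaceT; apply: (continuous_nrm id 1) => x y.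
  by rewrite mul1r.
exists (nrm c); first exact: nrm_ge0.
move=> x; have [->|/nrm_normalize[u u1 ->]] := eqVneq x 0.
  by rewrite linear0 nrm0 mulr0.
rewrite linearZ !nrmZ u1 mulr1 mulrC ler_wpM2r ?nrm_ge0//.
by apply: cmax; rewrite inE; apply: TB; rewrite u1.
Qed.

(** Let [A = T - lambda], which is injective. On unit vectors [x] with [A x]
    small, [T x = lambda x + A x] stays away from [0], so [T x] lies in the
    compact set [B1] of points of norm at least [|lambda| / 2] in the closure of
    the image of the unit ball. By injectivity [A] is bounded below on [B1], say by [m]; as [A] and [T] commute,
    [m <= |A (T x)| = |T (A x)| <= D |A x|], a lower bound on [|A x|]. *)
Lemma compact_operator_bounded_below (T : {linear V -> V})
    (lambda : scalars R k) :
  compact_operator T -> lambda != 0 ->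
  (forall x, T x = lambda *: x -> x = 0) ->
  exists C, forall x, nrm x <= C * nrm (T x - lambda *: x).
Proof.
move=> cT l0 inj.
have [D D0 TD] := compact_operator_bounded _ cT.
have := compact_unit_ball_image _ cT; set B := closure _ => cB.
pose A : {linear V -> V} := T \- lambda \*: idfun.
have AE x : A x = T x - lambda *: x by [].
pose L := nrm (lambda : scalars R k).
have L0 : 0 < L.
  by rewrite /L -(@of_real_gt0 _ k) of_realK ?normr_ge0// normr_gt0.
pose B1 := B `&` [set y | L / 2 <= nrm y].
have AT x : A (T x) = T (A x) by rewrite !AE (linearB T) (linearZ_LR T).
suff [d d0 dP] : exists2 d, 0 < d & forall x, nrm x = 1 -> d <= nrm (A x).
  exists d^-1 => x; rewrite mulrC ler_pdivlMr// -AE.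
  have [->|/nrm_normalize[u u1 ->]] := eqVneq x 0.
    by rewrite linear0 nrm0 mul0r.
  by rewrite linearZ !nrmZ u1 mulr1 ler_wpM2l ?nrm_ge0// dP.
have contB f C : (forall x y, nrm (f x - f y) <= C * nrm (x - y)) ->
    continuous (@nrm R k V \o f) by apply: continuous_nrm.
have [m m0 mP] : exists2 m, 0 < m & forall y, B1 y -> m <= nrm (A y).
  have [B1_0|/set0P B1_0] := eqVneq B1 set0.
    by exists 1 => // y; rewrite B1_0.
  have cB1 : compact B1.
    apply: compact_closedI => //.
    apply: (@closed_comp _ _ (@nrm R k V) [set t | L / 2 <= t]) => [y _|].
      by apply: (contB id 1) => u v; rewrite mul1r.
    exact: closed_ge.
  have [|c] := compact_EVT_min B1_0 cB1 (f := @nrm R k V \o A).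
    apply: continuous_subspaceT; apply: (contB _ (D + L)) => x y.
    rewrite -linearB AE (le_trans (nrm_triangle _ _))// nrmN nrmZ.
    by rewrite mulrDl lerD2r TD.
  rewrite inE => -[_ /= cL] cmin; exists (nrm (A c)); last first.
    by move=> y By; apply: cmin; rewrite inE.
  rewrite lt_neqAle nrm_ge0 andbT eq_sym; apply/eqP => /nrm_eq0.
  rewrite AE => /subr0_eq /inj c0; move: cL.
  by rewrite c0 nrm0 leNgt divr_gt0.
(* The summand 1 keeps the denominator positive when T = 0. *)
exists (Num.min (L / 2) (m / (D + 1))).
  by rewrite lt_min !divr_gt0// ltr_wpDl.
move=> x x1; rewrite ge_min; have [//|AxL] := leP (L / 2) (nrm (A x)).
rewrite /= ler_pdivrMr ?ltr_wpDl//.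
have /mP mTx : B1 (T x).
  split; first by apply: subset_closure; exists x => //=; rewrite x1.
  have := nrm_triangle (T x) (- A x).
  rewrite nrmN AE opprB addrC subrK nrmZ x1 mulr1 -AE -/L /mkset; lra.
rewrite (le_trans mTx)// AT (le_trans (TD _))// -AE mulrC ler_wpM2l ?nrm_ge0//.
by rewrite lerDl.
Qed.

End CompactOperators.

(** * Riesz representation and adjoints *)

(** Common source of the Cauchy-Schwarz inequality and of the approximate
    first-order condition at a near-minimiser. There [a] is a squared norm, and
    [a = 0] covers the directions that the operator kills. *)
Lemma quadratic_discr_le (R : realFieldType) (a b e : R) :
  0 <= a -> (forall t, 0 <= a * t ^+ 2 - 2 * b * t + e) -> b ^+ 2 <= a * e.
Proof.
rewrite le_eqVlt => /predU1P[<-|a0] h.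
  have [->|b0] := eqVneq b 0; first by rewrite mul0r expr0n.
  (* The affine function e - 2 b t takes the value -1 there. *)
  have := h ((e + 1) / (2 * b)).
  rewrite mul0r add0r mulrCA mulfV ?mulf_neq0// mulr1; lra.
have := h (b / a); rewrite -(ler_pM2l a0) mulr0.
have -> : a * (a * (b / a) ^+ 2 - 2 * b * (b / a) + e) = a * e - b ^+ 2.
  by field; rewrite gt_eqF.
by rewrite subr_ge0.
Qed.

Section Hilbert.
Context {R : realType} {k : scalar_kind}.
Local Notation K := (scalars R k).
Context {H : completeNormedModType K} (dot : {dot H for @scalar_conj R k}).
Hypothesis dotP : norm_from_dot dot.
Implicit Types (x y z : H) (t : R).

Lemma dotZr (a : K) x y : dot x (a *: y) = scalar_conj a * dot x y.
Proof. exact: linearZr_LR. Qed.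

Lemma dotC x y : dot x y = scalar_conj (dot y x).
Proof. by rewrite hermitian_subproof expr0 mul1r. Qed.

Let rdot x y : R := re_part (dot x y).

Lemma rdotC x y : rdot x y = rdot y x.
Proof. by rewrite /rdot dotC re_conj. Qed.

Lemma rdotDl x y z : rdot (x + y) z = rdot x z + rdot y z.
Proof. by rewrite /rdot linearDl raddfD. Qed.

Lemma rdotBl x y z : rdot (x - y) z = rdot x z - rdot y z.
Proof. by rewrite /rdot linearBl raddfB. Qed.

Lemma rdotZl t x y : rdot (of_real t *: x) y = t * rdot x y.
Proof. by rewrite /rdot linearZl_LR re_of_realM. Qed.

Lemma rdotxx x : rdot x x = nrm x ^+ 2.
Proof. by rewrite /rdot -dotP expr2 -{1}of_real_nrm re_of_realM. Qed.

Lemma nrm_sqDZ x y t :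
  nrm (x + of_real t *: y) ^+ 2 =
  nrm x ^+ 2 + 2 * t * rdot y x + nrm y ^+ 2 * t ^+ 2.
Proof.
rewrite -!rdotxx !(rdotDl, rdotZl) (rdotC x (_ + _)) (rdotC y (_ + _)).
rewrite !(rdotDl, rdotZl) (rdotC x y); ring.
Qed.

Lemma rdot_le x y : `|rdot x y| <= nrm x * nrm y.
Proof.
rewrite -(@ler_pXn2r _ 2)// ?nnegrE ?mulr_ge0 ?nrm_ge0// real_normK ?num_real//.
rewrite exprMn; apply: quadratic_discr_le => [|t]; first exact: sqr_ge0.
have := sqr_ge0 (nrm (y + of_real (- t) *: x)); rewrite nrm_sqDZ; lra.
Qed.

(** Riesz representation relative to [A]: a minimising sequence of
    [|A x|^2 - 2 Re (f x)] may itself diverge, but its image under [A] is a Cauchy sequence of [H], whose limit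
    represents [f]. *)
Lemma riesz_factor (U : lmodType K) (A : {linear U -> H}) (f : U -> K) (C : R) :
  scalar f -> (forall x : U, nrm (f x) <= C * nrm (A x)) ->
  exists z, forall x : U, f x = dot (A x) z.
Proof.
move=> flin fC.
pose F : {scalar U} := HB.pack f (GRing.isLinear.Build K U K *%R f flin).
have fD v w : f (v + w) = f v + f w by exact: (linearD F).
have fZ a v : f (a *: v) = a * f v by exact: (linearZ_LR F).
pose J (x : U) := nrm (A x) ^+ 2 - 2 * re_part (f x).
(* The derivative of J at x in the direction v is -2 * res x v. *)
pose res (x v : U) := re_part (f v) - rdot (A v) (A x).
have JE (x : U) t v : J (x + of_real t *: v) =
    J x - 2 * res x v * t + nrm (A v) ^+ 2 * t ^+ 2.
  rewrite /J fD fZ (raddfD re_part)/= re_of_realM linearD linearZ.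
  by rewrite nrm_sqDZ /res; ring.
(* Completing the square: |A x|^2 - 2 C |A x| >= - C^2. *)
have Jlb : has_lbound (range J).
  exists (- C ^+ 2) => _ [x _ <-]; rewrite /J.
  have := le_trans (le_trans (ler_norm _) (norm_re_le (f x))) (fC x).
  have := sqr_ge0 (nrm (A x) - C); rewrite sqrrB; lra.
have hasJ : has_inf (range J) by split=> //; exists (J 0), 0.
set m := inf (range J).
have res_le (x : U) e v : J x < m + e -> res x v ^+ 2 <= nrm (A v) ^+ 2 * e.
  move=> xe; apply: quadratic_discr_le => [|t]; first exact: sqr_ge0.
  have : m <= J (x + of_real t *: v).
    by apply: ge_inf => //; exists (x + of_real t *: v).
  rewrite JE; lra.
have /choice[u uJ] n : exists x : U, J x < m + n.+1%:R^-1.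
  have n0 : 0 < n.+1%:R^-1 :> R by rewrite invr_gt0.
  by have [_ [x _ <-] xJ] := inf_adherent n0 hasJ; exists x.
have resu n e v : n.+1%:R^-1 <= e -> res (u n) v ^+ 2 <= nrm (A v) ^+ 2 * e.
  by move=> ne; apply: res_le; apply: lt_le_trans (uJ n) _; rewrite lerD2l.
have inv_small e : 0 < e -> exists N, forall n, (N <= n)%N -> n.+1%:R^-1 < e :> R.
  move=> e0; have [N _ NP] := near_infty_natSinv_lt (PosNum e0).
  by exists N => n /NP.
(* With v the difference of two terms of the sequence, |A v|^2 is a difference
   of two residuals in the direction v, each at most sqrt e * |A v|. Hence
   |A v|^2 <= 4 e whenever both terms are within e of the infimum. *)
have [e e0|z zu] := @nrm_cauchy_cvg R k H (A \o u).
  have e4 : 0 < e ^+ 2 / 8 by rewrite divr_gt0// exprn_gt0.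
  have [N NP] := inv_small _ e4; exists N => n Nn /=.
  set v := u N - u n; have vE : A (u N) - A (u n) = A v by rewrite linearB.
  rewrite vE; have h1 := resu N _ v (ltW (NP N (leqnn _))).
  have h2 := resu n _ v (ltW (NP n Nn)).
  have h3 : nrm (A v) ^+ 2 = res (u n) v - res (u N) v.
    rewrite -rdotxx -{2}vE rdotC rdotBl /res.
    by rewrite (rdotC (A (u N))) (rdotC (A (u n))); ring.
  rewrite ltNge; apply/negP => ev.
  have h4 : e ^+ 2 <= nrm (A v) ^+ 2 by rewrite ler_pXn2r// nnegrE ?nrm_ge0// ltW.
  have e2 : 0 < e ^+ 2 by rewrite exprn_gt0.
  move: h1 h2 h3 h4 e2.
  move: (nrm (A v) ^+ 2) (e ^+ 2) (res _ _) (res _ _) => p q r s.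
  move=> h1 h2 h3 h4 q0; have := sqr_ge0 (r + s); nra.
have rez v : re_part (f v) = rdot (A v) z.
  suff small e : 0 < e -> `|re_part (f v) - rdot (A v) z| <= 2 * nrm (A v) * e.
    apply/eqP; rewrite -subr_eq0 -normr_le0; apply/ler_addgt0Pl => e e0.
    rewrite addr0.
    have v1 : 0 < 2 * nrm (A v) + 1 by rewrite ltr_wpDl// mulr_ge0// nrm_ge0.
    apply: le_trans (small (e / (2 * nrm (A v) + 1)) _) _; first exact: divr_gt0.
    by rewrite mulrCA ger_pMr// ler_pdivrMr// mul1r lerDl.
  move=> e0; have [N1 N1P] := inv_small (e ^+ 2) (exprn_gt0 _ e0).
  have [N2 N2P] := zu e e0; pose n := maxn N1 N2.
  have h1 := resu n _ v (ltW (N1P n (leq_maxl _ _))).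
  have h2 := N2P n (leq_maxr _ _).
  have -> : re_part (f v) - rdot (A v) z =
      res (u n) v - rdot (A v) (z - A (u n)).
    by rewrite (rdotC _ (z - _)) rdotBl /res !(rdotC (A v)); ring.
  rewrite (le_trans (ler_normB _ _))// -mulrA mulr_natl mulr2n lerD//.
    rewrite -(@ler_pXn2r _ 2)// ?nnegrE ?mulr_ge0 ?nrm_ge0 ?(ltW e0)//.
    by rewrite real_normK ?num_real// exprMn.
  by rewrite (le_trans (rdot_le _ _))// ler_wpM2l ?nrm_ge0// ltW.
exists z => v; apply/eqP; rewrite -subr_eq0; set h := f v - _.
(* Testing the real identity on conj h *: v turns the error h into |h|^2. *)
have := rez (scalar_conj h *: v) => /eqP.
rewrite fZ linearZ /rdot linearZl_LR -subr_eq0 -raddfB -mulrBr -/h conj_mul_norm.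
rewrite expr2 -{1}(of_realK _ (normr_ge0 h)) /= re_of_realM mulf_eq0 orbb => /eqP h0.
by rewrite (nrm_eq0 _ h0).
Qed.

(** The real part of [<conj d x, y>] is [|d|^2] for [d = <x, y>], so the bound on
    real parts suffices. *)
Lemma dot_le x y : nrm (dot x y) <= nrm x * nrm y.
Proof.
set d := dot x y.
have : rdot (scalar_conj d *: x) y <= nrm (scalar_conj d *: x) * nrm y.
  exact: le_trans (ler_norm _) (rdot_le _ _).
rewrite /rdot linearZl_LR conj_mul_norm expr2 -{1}(of_realK _ (normr_ge0 d)).
have -> : nrm (scalar_conj d *: x) = nrm d * nrm x by rewrite nrmZ /nrm norm_conj.
rewrite re_of_realM -/(nrm d) -mulrA.
have [->|dn0] := eqVneq (nrm d) 0; first by rewrite mulr_ge0 ?nrm_ge0.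
by rewrite ler_pM2l// lt_neqAle eq_sym dn0 nrm_ge0.
Qed.

Lemma dot_eqr u v : (forall x, dot x u = dot x v) -> u = v.
Proof.
move=> uv; apply/eqP; rewrite -subr_eq0; apply: contraT.
move=> /(neq0_dnorm_gt0 (s := dot)).
by rewrite linearBr /= uv subrr ltxx.
Qed.

(** For each [y] the functional [<T ., y>] is bounded, hence represented by a
    vector; uniqueness of that vector makes it linear in [y]. *)
Lemma adjointP (T : {linear H -> H}) (C : R) :
  (forall x, nrm (T x) <= C * nrm x) -> is_adjoint dot T (adjoint dot T).
Proof.
move=> TC; rewrite /adjoint; case: pselect => [ex|[]]; first exact: svalP (cid ex).
have /choice[S TS] y : exists z, forall x, dot (T x) y = dot x z.
  apply: (riesz_factor _ idfun (fun x => dot (T x) y) (C * nrm y)).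
    by move=> a u v; rewrite linearP linearPl.
  by move=> x; rewrite (le_trans (dot_le _ _))// mulrAC ler_wpM2r ?nrm_ge0//.
have Slin : linear S.
  move=> a u v; apply: dot_eqr => x.
  by rewrite -TS !linearDr /= !dotZr !TS.
by exists (HB.pack S (GRing.isLinear.Build K H H *:%R S Slin) : {linear H -> H}).
Qed.

(** A solution of [S x = y] is a vector representing [<., y>] through [A]. *)
Lemma adjoint_surjective (A : {linear H -> H}) (S : H -> H) (C : R) :
  (forall x y, dot (A x) y = dot x (S y)) ->
  (forall x, nrm x <= C * nrm (A x)) ->
  forall y, exists x, S x = y.
Proof.
move=> AS AC y.
have [||z zP] := riesz_factor _ A (fun x => dot x y) (C * nrm y).
- by move=> a u v; rewrite linearPl.
- by move=> x; rewrite (le_trans (dot_le _ _))// mulrAC ler_wpM2r ?nrm_ge0//.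
by exists z; apply: dot_eqr => x; rewrite -AS -zP.
Qed.

End Hilbert.

Theorem theorem9 (R : realType) (k : scalar_kind)
    (H : completeNormedModType (scalars R k))
    (dot : {dot H for @scalar_conj R k}) (dotP : norm_from_dot dot)
    (infH : ~ finite_dimensional H)
    (T : {linear H -> H}) (compactT : compact_operator T) :
  point_spectrum T `\ 0 =
  [set lambda : scalars R k | lambda != 0 /\
    TP (operator_family
          (adjoint dot T \- (scalar_conj lambda \*: idfun)))].
Proof.
have [D _ TD] := compact_operator_bounded _ compactT.
have adjT : is_adjoint dot T (adjoint dot T) := adjointP dot dotP _ _ TD.
have adjE lambda x y : dot (T x - lambda *: x) y =
    dot x ((adjoint dot T \- scalar_conj lambda \*: idfun) y).
  by rewrite linearBl linearZl_LR linearBr /= (dotZr dot) scalar_conjK adjT.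
apply/seteqP; split=> [lambda [[x x0 Tx] /eqP l0]|lambda [l0 [[[y yran] _] _]]].
  split=> //.
  set S : {linear H -> H} := adjoint dot T \- scalar_conj lambda \*: idfun.
  have nsurj : ~ surjective_op S.
    move=> /(_ x)[y Sy]; have := neq0_dnorm_gt0 (s := dot) x x0.
    by rewrite -{2}Sy -adjE Tx subrr linear0l ltxx.
  by split; [exact: operator_family_cone|exists S].
split; last exact/eqP.
apply: contrapT => noteig.
have [x Tx|C TC] := compact_operator_bounded_below _ _ compactT l0.
  by apply: contrapT => /eqP x0; apply: noteig; exists x.
have [x Sx] := @adjoint_surjective _ _ _ dot dotP (T \- lambda \*: idfun) _ C
  (adjE lambda) TC y.
by move/negP: yran; apply; apply/asboolP; exists x.
Qed.
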